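(* Let $F$ be a differentially closed field of characteristic zero with derivations $d_x,d_y$, and let $P=d_y^2+p_1d_x+p_2d_y+p_3\in F[d_x,d_y]$ with $p_1,p_2,p_3\in F$ be a second-order operator (with non-separable symbol $\mathrm{symb}(P)=w^2$). Then the principal left ideal $\langle P\rangle\subset F[d_x,d_y]$ has (i) no proper non-holonomic overideals if $p_1\neq 0$; (ii) an infinite number of maximal non-holonomic overideals if $p_1=0$.
   Context: The derivations $d_x,d_y$ of $F$ commute, and $F[d_x,d_y]$ is the (non-commutative) ring of linear partial differential operators $\sum_{i,j}p_{i,j}d_x^id_y^j$ with coefficients $p_{i,j}\in F$, where $d_xd_y=d_yd_x$, $d_x f=f d_x+d_x(f)$ and $d_y f=f d_y+d_y(f)$ for $f\in F$. All ideals are left ideals, and $\langle P\rangle$ denotes the left ideal generated by $P$. For an operator $P=\sum_{i+j\le n}p_{i,j}d_x^id_y^j$ of order $n$, its symbol is the homogeneous polynomial $\mathrm{symb}(P)=\sum_{i+j=n}p_{i,j}v^iw^j\in F[v,w]$ of degree $n$. It is separable if it has no multiple linear factors. For a left ideal $I$, the Hilbert-Kolchin polynomial is the polynomial in $z$ which for all large integers $z$ equals the $F$-dimension of the image in $F[d_x,d_y]/I$ of the space of operators of order at most $z$. The ideal $I$ is called non-holonomic if its Hilbert-Kolchin polynomial has degree exactly $1$. An overideal of an ideal $J$ is a left ideal containing $J$; it is proper if it is different from $J$. A maximal non-holonomic overideal of $J$ is a non-holonomic overideal of $J$ (possibly $J$ itself) which is maximal with respect to inclusion among all non-holonomic overideals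 of $J$. *)

(* Defs.v *)
From HB Require Import structures.
From mathcomp Require Import all_boot all_order all_algebra.
From mathcomp Require Import boolp classical_sets cardinality.
From mathcomp Require Import ssrcomplements mpoly.

Set Implicit Arguments.
Unset Strict Implicit.
Unset Printing Implicit Defensive.

Import Order.TTheory GRing.Theory Num.Theory.

Local Open Scope classical_set_scope.
Local Open Scope ring_scope.

HB.mixin Record Field_isDifferential2 F of GRing.Field F := {
  der_x : F -> F;
  der_y : F -> F;
  der_xD : {morph der_x : a b / a + b};
  der_yD : {morph der_y : a b / a + b};
  der_xM : forall a b, der_x (a * b) = der_x a * b + a * der_x b;
  der_yM : forall a b, der_y (a * b) = der_y a * b + a * der_y b;
  der_xyC : forall a, der_x (der_y a) = der_y (der_x a)
}.

#[short(type="diffFieldType")]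
HB.structure Definition DiffField :=
  {F of GRing.Field F & Field_isDifferential2 F}.

(* Expressions for the differential polynomials over [F] in the differential
   indeterminates [DPvar 0, DPvar 1, ...]. *)
Inductive dpoly (F : Type) : Type :=
| DPvar of nat
| DPconst of F
| DPadd of dpoly F & dpoly F
| DPmul of dpoly F & dpoly F
| DPdx of dpoly F
| DPdy of dpoly F.

Arguments DPvar {F}.

Fixpoint dp_eval (F : Type) (E : diffFieldType) (iota : F -> E) (a : nat -> E)
    (p : dpoly F) : E :=
  match p with
  | DPvar k => a k
  | DPconst c => iota c
  | DPadd p1 p2 => dp_eval iota a p1 + dp_eval iota a p2
  | DPmul p1 p2 => dp_eval iota a p1 * dp_eval iota a p2
  | DPdx p1 => der_x (dp_eval iota a p1)
  | DPdy p1 => der_y (dp_eval iota a p1)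
  end.

Definition dp_solution (F : Type) (E : diffFieldType) (iota : F -> E)
    (eqs neqs : seq (dpoly F)) (a : nat -> E) : Prop :=
  all (fun p => dp_eval iota a p == 0) eqs /\
  all (fun p => dp_eval iota a p != 0) neqs.

(* Ring morphisms between fields are injective: [E] is a differential field
   extension of [F]. *)
Definition diff_embedding (F E : diffFieldType) (iota : {rmorphism F -> E}) :=
  (forall a, iota (der_x a) = der_x (iota a)) /\
  (forall a, iota (der_y a) = der_y (iota a)).

(* Existential closedness in the class of differential fields with two
   commuting derivations. *)
Definition differentially_closed (F : diffFieldType) : Prop :=
  forall eqs neqs : seq (dpoly F),
    (exists (E : diffFieldType) (iota : {rmorphism F -> E}),
        diff_embedding iota /\ exists a, dp_solution iota eqs neqs a) ->
    exists a : nat -> F, dp_solution id eqs neqs a.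

(* [sum p_ij d_x^i d_y^j], with coefficients on the left, is encoded by
   [sum p_ij 'X_0^i 'X_1^j]; the copy of the polynomial module receives below
   the multiplication of differential operators. *)
Definition diffop (F : diffFieldType) : Type := {mpoly F[2]}.

HB.instance Definition _ (F : diffFieldType) :=
  GRing.Lmodule.on (diffop F).

Section DiffopRing.
Variable F : diffFieldType.
Implicit Types (c f : F) (p q r : {mpoly F[2]}) (m : 'X_{1..2}) (i j : 'I_2).

Definition der i : F -> F := if i == ord0 then @der_x F else @der_y F.

Lemma derD i : {morph der i : a b / a + b}.
Proof. by rewrite /der; case: ifP => _; [exact: der_xD | exact: der_yD]. Qed.

Lemma derM i a b : der i (a * b) = der i a * b + a * der i b.
Proof. by rewrite /der; case: ifP => _; [exact: der_xM | exact: der_yM]. Qed.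

Lemma der0 i : der i 0 = 0.
Proof. by apply: (@addIr _ (der i 0)); rewrite -derD !add0r. Qed.

Lemma derN i a : der i (- a) = - der i a.
Proof. by apply/eqP; rewrite -addr_eq0 -derD addNr der0. Qed.

Lemma derB i : {morph der i : a b / a - b}.
Proof. by move=> a b /=; rewrite derD derN. Qed.

HB.instance Definition _ i := GRing.isZmodMorphism.Build F F (der i) (derB i).

Lemma der1 i : der i 1 = 0.
Proof.
by apply: (@addIr _ (der i 1)); rewrite add0r -{3}[1]mulr1 derM mulr1 mul1r.
Qed.

Lemma derC i j a : der i (der j a) = der j (der i a).
Proof.
by rewrite /der; case: (i == _); case: (j == _); rewrite // der_xyC.
Qed.

(* Left multiplication by d_x ([i = 0]) or d_y ([i = 1]):
   [d (c X^m) = c d X^m + d(c) X^m]. *)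
Definition dmul i q : {mpoly F[2]} := 'X_i * q + map_mpoly (der i) q.

(* Left multiplication by [d_x^(m 0) d_y^(m 1)]. *)
Definition dmulm m q : {mpoly F[2]} :=
  iter (m ord0) (dmul ord0) (iter (m ord_max) (dmul ord_max) q).

Definition diffop_mul (p q : diffop F) : diffop F :=
  \sum_(m <- msupp p) p@_m *: dmulm m q.

Lemma mcoeff_map_der i q m : (map_mpoly (der i) q)@_m = der i q@_m.
Proof. exact: mcoeff_map_mpoly. Qed.

Lemma dmulB i : {morph dmul i : p q / p - q}.
Proof.
by move=> p q; rewrite /dmul mulrBr raddfB /= opprD addrACA.
Qed.

HB.instance Definition _ i :=
  GRing.isZmodMorphism.Build {mpoly F[2]} {mpoly F[2]} (dmul i) (dmulB i).

Lemma dmulD i : {morph dmul i : p q / p + q}.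
Proof. exact: raddfD. Qed.

Lemma dmulZ i c p : dmul i (c *: p) = c *: dmul i p + der i c *: p.
Proof.
rewrite /dmul scalerDr -scalerAr -addrA; congr (_ + _); apply/mpolyP => m.
by rewrite mcoeff_map_der mcoeffD !mcoeffZ mcoeff_map_der derM addrC.
Qed.

Lemma dmulX i m : dmul i 'X_[m] = 'X_[U_(i) + m].
Proof.
rewrite /dmul mpolyXD -[RHS]addr0; congr (_ + _); apply/mpolyP => k.
by rewrite mcoeff_map_der mcoeffX mcoeff0; case: eqP; rewrite ?der1 ?der0.
Qed.

Lemma dmulC i j p : dmul i (dmul j p) = dmul j (dmul i p).
Proof.
elim/mpolyind: p => [|c m p _ _ IH]; first by rewrite !raddf0.
rewrite !(dmulD _ (c *: 'X_[m])) !(dmulD _ (dmul _ (c *: 'X_[m]))) IH.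
congr (_ + _); rewrite !(dmulZ _ c) !dmulX.
rewrite !(dmulD _ (c *: _)) !dmulZ !dmulX.
rewrite (derC j) !addmA (addmC U_(i)%MM) -!addrA; congr (_ + _).
by rewrite addrCA.
Qed.

Lemma dmulmB m : {morph dmulm m : p q / p - q}.
Proof.
move=> p q; rewrite /dmulm; elim: (m ord0) => [|n /= ->]; last exact: raddfB.
by elim: (m ord_max) => [|n /= ->] //; exact: raddfB.
Qed.

HB.instance Definition _ m :=
  GRing.isZmodMorphism.Build {mpoly F[2]} {mpoly F[2]} (dmulm m) (dmulmB m).

Lemma dmulmU i m p : dmulm (U_(i) + m) p = dmul i (dmulm m p).
Proof.
rewrite /dmulm !mnmE; case: i => -[|[|//]] Hi.
  by rewrite (_ : Ordinal Hi = ord0) //; apply: val_inj.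
rewrite (_ : Ordinal Hi = ord_max); last exact: val_inj.
rewrite /= add0n; elim: (m ord0) => //= n ->; exact: dmulC.
Qed.

Lemma dmulm0 p : dmulm 0%MM p = p.
Proof. by rewrite /dmulm !mnm0E. Qed.

Lemma dmulm1 m : dmulm m 1 = 'X_[m].
Proof.
have H n i k : iter n (dmul i) 'X_[k] = 'X_[U_(i) *+ n + k].
  elim: n => [|n /= ->]; first by rewrite mulm0n add0m.
  by rewrite dmulX addmA mulmS.
rewrite /dmulm -mpolyX0 !H addm0; congr 'X_[_]; apply/mnmP => -[[|[|//]] Hi];
  by rewrite mnmDE !mulmnE !mnm1E /= ?mul1n ?mul0n ?addn0 ?add0n;
  congr (m _); apply: val_inj.
Qed.

Lemma diffop_mulw k (p q : diffop F) : (msize p <= k)%N ->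
  diffop_mul p q = \sum_(m : 'X_{1..2 < k}) p@_m *: dmulm m q.
Proof.
move=> lek; pose I : subFinType _ := 'X_{1..2 < k}.
rewrite /diffop_mul (big_mksub I) //=; first last.
- by move=> x /msize_mdeg_lt /leq_trans /(_ lek) ->.
- by rewrite msupp_uniq.
by rewrite big_rmcond //= => i /memN_msupp_eq0 ->; rewrite scale0r.
Qed.

Lemma diffop_mulPl c p1 p2 q :
  diffop_mul (c *: p1 + p2) q = c *: diffop_mul p1 q + diffop_mul p2 q.
Proof.
pose k := (msize (c *: p1 + p2) + (msize p1 + msize p2))%N.
rewrite !(@diffop_mulw k) /k ?leq_addr //; first last.
- by rewrite addnCA leq_addr.
- by rewrite addnA leq_addl.
rewrite scaler_sumr -big_split /=; apply: eq_bigr => m _.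
by rewrite mcoeffD mcoeffZ scalerDl scalerA.
Qed.

Lemma diffop_mulDl : left_distributive diffop_mul +%R.
Proof. by move=> p1 p2 q; have := diffop_mulPl 1 p1 p2 q; rewrite !scale1r. Qed.

Lemma diffop_mul0l q : diffop_mul 0 q = 0.
Proof. by rewrite /diffop_mul msupp0 big_nil. Qed.

Lemma diffop_mulZl c p q : diffop_mul (c *: p) q = c *: diffop_mul p q.
Proof. by have := diffop_mulPl c p 0 q; rewrite diffop_mul0l !addr0. Qed.

Lemma diffop_mulDr : right_distributive diffop_mul +%R.
Proof.
move=> p q1 q2; rewrite /diffop_mul -big_split /=; apply: eq_bigr => m _.
by rewrite raddfD scalerDr.
Qed.

Lemma diffop_mulXl m q : diffop_mul 'X_[m] q = dmulm m q.
Proof. by rewrite /diffop_mul msuppX big_seq1 mcoeffX eqxx scale1r. Qed.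

Lemma diffop_mul1r : left_id (1 : {mpoly F[2]}) diffop_mul.
Proof. by move=> q; rewrite -mpolyX0 diffop_mulXl dmulm0. Qed.

Lemma diffop_mulr1 : right_id (1 : {mpoly F[2]}) diffop_mul.
Proof.
move=> p; rewrite [RHS]mpolyE; apply: eq_bigr => m _.
by rewrite dmulm1.
Qed.

Lemma dmul_diffop_mul i p q :
  dmul i (diffop_mul p q) = diffop_mul (dmul i p) q.
Proof.
elim/mpolyind: p => [|c m p _ _ IH].
  by rewrite diffop_mul0l !raddf0 diffop_mul0l.
rewrite diffop_mulDl !dmulD diffop_mulDl IH; congr (_ + _).
rewrite diffop_mulZl !dmulZ diffop_mulDl !diffop_mulZl dmulX !diffop_mulXl.
by rewrite dmulmU.
Qed.

Lemma dmulm_diffop_mul m p q :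
  dmulm m (diffop_mul p q) = diffop_mul (dmulm m p) q.
Proof.
rewrite /dmulm; elim: (m ord0) => [|n /= ->]; last exact: dmul_diffop_mul.
by elim: (m ord_max) => [|n /= ->] //; exact: dmul_diffop_mul.
Qed.

Lemma diffop_mulA : associative diffop_mul.
Proof.
move=> p q r; elim/mpolyind: p => [|c m p _ _ IH]; first by rewrite !diffop_mul0l.
rewrite !diffop_mulDl IH; congr (_ + _).
by rewrite !diffop_mulZl !diffop_mulXl dmulm_diffop_mul.
Qed.

Lemma diffop_oner_neq0 : (1 : {mpoly F[2]}) != 0.
Proof. exact: oner_neq0. Qed.

End DiffopRing.

HB.instance Definition _ (F : diffFieldType) :=
  GRing.Zmodule_isNzRing.Build (diffop F) (@diffop_mulA F) (@diffop_mul1r F)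
    (@diffop_mulr1 F) (@diffop_mulDl F) (@diffop_mulDr F) (diffop_oner_neq0 F).

(* [f%:A] is the operator of multiplication by [f : F]. *)
HB.instance Definition _ (F : diffFieldType) :=
  GRing.Lmodule_isLalgebra.Build F (diffop F)
    (fun c p q => esym (diffop_mulZl c p q)).

Definition Dx {F : diffFieldType} : diffop F := 'X_(ord0 : 'I_2).
Definition Dy {F : diffFieldType} : diffop F := 'X_(ord_max : 'I_2).

Section DiffopTheory.
Variable F : diffFieldType.

Lemma diffop_mulE (p q : diffop F) : p * q = diffop_mul p q.
Proof. by []. Qed.

Lemma DxE (q : diffop F) : Dx * q = dmul ord0 q.
Proof. by rewrite diffop_mulE [LHS]diffop_mulXl -[U_(_)%MM]addm0 dmulmU dmulm0. Qed.

Lemma DyE (q : diffop F) : Dy * q = dmul ord_max q.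
Proof. by rewrite diffop_mulE [LHS]diffop_mulXl -[U_(_)%MM]addm0 dmulmU dmulm0. Qed.

Lemma DxyC : (Dx : diffop F) * Dy = Dy * Dx.
Proof. by rewrite DxE DyE !dmulX addmC. Qed.

Lemma Dx_scalar (f : F) : Dx * f%:A = f%:A * Dx + (der_x f)%:A :> diffop F.
Proof. by rewrite -scalerAl mul1r DxE dmulZ -DxE mulr1. Qed.

Lemma Dy_scalar (f : F) : Dy * f%:A = f%:A * Dy + (der_y f)%:A :> diffop F.
Proof. by rewrite -scalerAl mul1r DyE dmulZ -DyE mulr1. Qed.

Lemma diffop_monomialE (m : 'X_{1..2}) :
  'X_[m] = Dx ^+ m ord0 * Dy ^+ m ord_max :> diffop F.
Proof.
rewrite -[LHS](@mulr1 (diffop F)) [LHS]diffop_mulXl /dmulm.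
have -> : iter (m ord_max) (dmul ord_max) 1 = Dy ^+ m ord_max :> diffop F.
  by elim: (m ord_max) => [|n /= ->] //; rewrite -DyE exprS.
elim: (m ord0) => [|n /= ->]; first by rewrite expr0 mul1r.
by rewrite -DxE exprS mulrA.
Qed.

Lemma diffopE (p : diffop F) :
  p = \sum_(m <- msupp p) p@_m *: (Dx ^+ m ord0 * Dy ^+ m ord_max).
Proof.
by rewrite [LHS]mpolyE; apply: eq_bigr => m _; rewrite -diffop_monomialE.
Qed.

End DiffopTheory.

(* [msize P] is the total degree of [P] plus one, and [0] if [P = 0]. *)
Definition op_order (F : diffFieldType) (P : diffop F) : nat := (msize P).-1.

Definition symb (F : diffFieldType) (P : diffop F) : {mpoly F[2]} :=
  pihomog mdeg (op_order P) P.

Definition separable_form (F : fieldType) (s : {mpoly F[2]}) : Prop :=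
  ~ exists l q : {mpoly F[2]}, [/\ l != 0, l \is 1.-homog & s = l ^+ 2 * q].

Lemma op_order_symb_dy2 (F : diffFieldType) (p1 p2 p3 : F) :
  let P : diffop F := Dy ^+ 2 + p1 *: Dx + p2 *: Dy + p3%:A in
  [/\ op_order P = 2%N, symb P = 'X_(ord_max) ^+ 2 & ~ separable_form (symb P)].
Proof.
move=> P.
have EP : P = 'X_[U_(ord_max) + U_(ord_max)] + p1 *: 'X_[U_(ord0)]
    + p2 *: 'X_[U_(ord_max)] + p3 *: 'X_[0] :> {mpoly F[2]}.
  by rewrite /P expr2 DyE dmulX mpolyX0.
have oP : op_order P = 2%N.
  have ub : (msize P <= 3)%N.
    have le3 c m : (mdeg m < 3)%N -> (msize (c *: 'X_[m] : {mpoly F[2]}) <= 3)%N.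
      by move=> lt; apply: leq_trans (msizeZ_le _ _) _; rewrite msizeX.
    rewrite EP.
    do 3?[apply: leq_trans (msizeD_le _ _) _; rewrite geq_max; apply/andP; split].
    - by rewrite msizeX mdegD !mdeg1.
    - by apply: le3; rewrite mdeg1.
    - by apply: le3; rewrite mdeg1.
    - by apply: le3; rewrite mdeg0.
  have lb : (2 < msize P)%N.
    pose m2 : 'X_{1..2} := (U_(ord_max) + U_(ord_max))%MM.
    have d2 : mdeg m2 = 2%N by rewrite mdegD !mdeg1.
    suff /msize_mdeg_lt : m2 \in msupp P by rewrite d2.
    have ne m : mdeg m != 2%N -> (m == m2) = false.
      by apply: contraNF => /eqP ->; rewrite d2.
    rewrite mcoeff_msupp EP !mcoeffD !mcoeffZ !mcoeffX eqxx.
    by rewrite !ne ?mdeg1 ?mdeg0 // !mulr0 !addr0 oner_neq0.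
  by rewrite /order; apply/eqP; rewrite -eqSS prednK ?(ltn_trans _ lb) // eqn_leq ub.
have sP : symb P = 'X_(ord_max) ^+ 2.
  rewrite /symb oP EP !pihomogD !linearZ /= !pihomogX /= mdegD !mdeg1 mdeg0 /=.
  by rewrite !scaler0 !addr0 expr2 -mpolyXD.
split=> //; rewrite sP; apply; exists 'X_(ord_max), 1.
split; [by rewrite -msize_poly_eq0 msizeX | by rewrite dhomogX /= mdeg1 | by rewrite mulr1].
Qed.

Section Ideals.
Variable F : diffFieldType.
Implicit Types (I J M : set (diffop F)) (P : diffop F).

Definition left_ideal I : Prop :=
  [/\ I 0, forall u v, I u -> I v -> I (u + v) & forall a u, I u -> I (a * u)].

Definition principal_ideal P : set (diffop F) := [set A * P | A in setT].

Definition overideal J I : Prop := left_ideal I /\ J `<=` I.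

Definition proper_overideal J I : Prop := overideal J I /\ I <> J.

Definition order_le (z : nat) : set (diffop F) := [set Q | (msize Q <= z.+1)%N].

(* The image of the subspace [V] in [F[d_x, d_y] / I] has dimension [k]:
   the classes of some [e_0, ..., e_(k-1)] in [V] form a basis of it. *)
Definition image_dim I (V : set (diffop F)) (k : nat) : Prop :=
  exists e : 'I_k -> diffop F,
    [/\ forall i, V (e i),
        forall c : 'I_k -> F, I (\sum_i c i *: e i) -> forall i, c i = 0
      & forall v, V v -> exists c : 'I_k -> F, I (v - \sum_i c i *: e i)].

Definition Hilbert_Kolchin I (h : {poly rat}) : Prop :=
  exists N, forall z, (N <= z)%N ->
    exists k, image_dim I (order_le z) k /\ h.[z%:R] = k%:R.

Definition non_holonomic I : Prop :=
  exists h : {poly rat}, Hilbert_Kolchin I h /\ size h = 2%N.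

Definition maximal_non_holonomic_overideal J M : Prop :=
  [/\ overideal J M, non_holonomic M &
      forall M', overideal J M' -> non_holonomic M' -> M `<=` M' -> M' = M].

Lemma principal_idealP P :
  [/\ left_ideal (principal_ideal P), principal_ideal P P &
      forall I, left_ideal I -> I P -> principal_ideal P `<=` I].
Proof.
split=> [||I [_ _ IM] IP _ [A _ <-]]; last exact: IM.
  split=> [|_ _ [A _ <-] [B _ <-]|a _ [A _ <-]]; first by exists 0; rewrite ?mul0r.
    by exists (A + B); rewrite ?mulrDl.
  by exists (a * A); rewrite ?mulrA.
by exists 1; rewrite ?mul1r.
Qed.

End Ideals.

(* Main.v *)
Require Import Defs.
From HB Require Import structures.
From mathcomp Require Import all_boot all_order all_algebra.
From mathcomp Require Import boolp classical_sets cardinality.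
From mathcomp Require Import mpoly.
From mathcomp Require Import functions fraction ring.

Set Implicit Arguments.
Unset Strict Implicit.
Unset Printing Implicit Defensive.

Import Order.TTheory GRing.Theory Num.Theory.

Local Open Scope classical_set_scope.
Local Open Scope ring_scope.

(** Both parts rest on one remark. Let [d] be one of [d_x], [d_y], and let [J]
    be a left ideal such that every operator is congruent mod [J] to some
    [sum_k c_k d^k]; in other words [F[d_x, d_y] / J] is a cyclic module over
    the ring [F[d]] of ordinary differential operators. An overideal [I] of [J]
    other than [J] contains a non-zero ordinary operator in [d], of order [n]
    say; dividing by it, [F[d_x, d_y] / I] is spanned over [F] by
    [1, d, ..., d^(n-1)], so the Hilbert-Kolchin polynomial of [I] is constant
    and [I] is not non-holonomic ([non_holonomic_overideal_cyclic]).

    (i) If [p1 != 0], the relation [P = 0] expresses [d_x] as an operator in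
    [d_y], so the remark applies to [J = <P>] and [d = d_y] ([reducible_dy]).

    (ii) If [p1 = 0] and [u] solves the Riccati equation
    [d_y u + u^2 + p2 u + p3 = 0], then [P = (d_y + p2 + u) (d_y - u)]. Modulo
    [d_y - u] every operator is congruent to exactly one operator in [d_x], of
    no larger order ([reducible_dx], [dx_free]); hence [<d_y - u>] has
    Hilbert-Kolchin polynomial [z + 1], and by the remark with [d = d_x] it is a
    maximal non-holonomic overideal. Different [u] give different ideals, so it
    remains to find infinitely many solutions [u] in [F].

    Since [F] is differentially closed, it suffices to find, for every finite
    list of elements of [F], a solution outside that list in some differential
    field extension. Take the fraction field of [F[[t]]], with [d_x] acting on
    coefficients and [d_y] acting as its action on coefficients plus [d/dt].
    These derivations commute and extend those of [F], and the Riccati equation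
    becomes a recursion for the coefficients of a series, which in
    characteristic zero has a solution with any prescribed constant term
    ([fps_riccati]); as [F] is infinite, the constant term can be chosen outside
    the list. *)


(** * Formal power series *)

Definition fps (R : Type) : Type := nat -> R.

HB.instance Definition _ (R : zmodType) := GRing.Zmodule.on (fps R).

Lemma fpsDE (R : zmodType) (f g : fps R) n : (f + g) n = f n + g n.
Proof. by []. Qed.

Section FpsRing.
Variable R : comNzRingType.
Implicit Types f g h : fps R.

Definition fps_trunc N f : {poly R} := \poly_(i < N.+1) f i.

(** The Cauchy product, read off a product of polynomials. *)
Definition fps_mul f g : fps R := fun n => (fps_trunc n f * fps_trunc n g)`_n.

Definition fps_const (c : R) : fps R := fun n => if n is 0 then c else 0.

Lemma coef_fps_trunc N f i : (i <= N)%N -> (fps_trunc N f)`_i = f i.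
Proof. by move=> leiN; rewrite coef_poly ltnS leiN. Qed.

Lemma fps_mulE f g n : fps_mul f g n = \sum_(i < n.+1) f i * g (n - i)%N.
Proof.
rewrite /fps_mul coefM; apply: eq_bigr => i _.
by rewrite !coef_fps_trunc ?leq_subr // -ltnS.
Qed.

(** Products can be computed on any sufficiently long truncation, so that the
    ring axioms for series follow from those for polynomials. *)
Lemma fps_mul_trunc N f g n : (n <= N)%N ->
  fps_mul f g n = (fps_trunc N f * fps_trunc N g)`_n.
Proof.
move=> lenN; rewrite fps_mulE coefM; apply: eq_bigr => i _.
rewrite !coef_fps_trunc //; first exact: leq_trans (leq_subr _ _) lenN.
by apply: leq_trans lenN; rewrite -ltnS.
Qed.

Lemma fps_mulC : commutative fps_mul.
Proof. by move=> f g; apply: funext => n; rewrite /fps_mul mulrC. Qed.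

Lemma fps_mulA : associative fps_mul.
Proof.
move=> f g h; apply: funext => n; rewrite !fps_mulE.
transitivity (fps_trunc n f * fps_trunc n g * fps_trunc n h)`_n.
  rewrite -mulrA coefM; apply: eq_bigr => i _.
  by rewrite coef_fps_trunc -1?ltnS // (fps_mul_trunc _ _ (leq_subr i n)).
rewrite coefM; apply: eq_bigr => i _.
by rewrite coef_fps_trunc ?leq_subr // (@fps_mul_trunc n) // -ltnS.
Qed.

Lemma fps_const_mulE c f n : fps_mul (fps_const c) f n = c * f n.
Proof.
rewrite fps_mulE big_ord_recl /= subn0 big1 ?addr0 // => i _.
by rewrite mul0r.
Qed.

Lemma fps_mul1 : left_id (fps_const 1) fps_mul.
Proof. by move=> f; apply: funext => n; rewrite fps_const_mulE mul1r. Qed.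

Lemma fps_mulDl : left_distributive fps_mul +%R.
Proof.
move=> f g h; apply: funext => n; rewrite fpsDE !fps_mulE.
by rewrite -big_split; apply: eq_bigr => i _; rewrite mulrDl.
Qed.

Lemma fps_one_neq0 : fps_const 1 != 0 :> fps R.
Proof. by apply/eqP => /(congr1 (fun f : fps R => f 0%N)) /eqP; rewrite oner_eq0. Qed.

HB.instance Definition _ := GRing.Zmodule_isComNzRing.Build (fps R)
  fps_mulA fps_mulC fps_mul1 fps_mulDl fps_one_neq0.

Lemma fpsME f g n : (f * g) n = \sum_(i < n.+1) f i * g (n - i)%N.
Proof. exact: fps_mulE. Qed.

Lemma fps_constME c f n : (fps_const c * f) n = c * f n.
Proof. exact: fps_const_mulE. Qed.

Lemma fps_const_is_zmod_morphism : zmod_morphism fps_const.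
Proof.
by move=> a b; apply: funext => -[|n] //; rewrite -[RHS]/(0 - 0) subr0.
Qed.

Lemma fps_const_is_monoid_morphism : monoid_morphism fps_const.
Proof.
split=> // a b; apply: funext => n; rewrite fps_constME.
by case: n => // n; rewrite mulr0.
Qed.

HB.instance Definition _ :=
  GRing.isZmodMorphism.Build R (fps R) fps_const fps_const_is_zmod_morphism.
HB.instance Definition _ :=
  GRing.isMonoidMorphism.Build R (fps R) fps_const fps_const_is_monoid_morphism.

Definition fps_unit : {pred fps R} := fun f => `[< exists g, g * f = 1 >].

Definition fps_inv f : fps R :=
  if pselect (exists g, g * f = 1) is left fV then projT1 (cid fV) else f.

Lemma fps_mulVf : {in fps_unit, left_inverse 1 fps_inv *%R}.
Proof.
by move=> f /asboolP fV; rewrite /fps_inv; case: pselect => // ?; case: cid.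
Qed.

Lemma fps_unitP f g : g * f = 1 -> fps_unit f.
Proof. by move=> gf1; apply/asboolP; exists g. Qed.

Lemma fps_inv_out : {in [predC fps_unit], fps_inv =1 id}.
Proof.
by move=> f /negP nfV; rewrite /fps_inv; case: pselect => // fV; case: nfV; apply/asboolP.
Qed.

HB.instance Definition _ := GRing.ComNzRing_hasMulInverse.Build (fps R)
  fps_mulVf fps_unitP fps_inv_out.

End FpsRing.

(** The lowest-order terms of two non-zero series multiply to a non-zero
    coefficient. *)
Lemma fps_mulf_eq0 (R : idomainType) : GRing.integral_domain_axiom (fps R).
Proof.
move=> f g fg0; apply: contraPT fg0; rewrite negb_or => /andP[f0 g0].
have low (h : fps R) : h != 0 -> exists2 n, h n != 0 & forall m, (m < n)%N -> h m = 0.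
  move=> h0; have /ex_minnP[n hn min_n] : exists n, h n != 0.
    apply: contrapT => hz; case/eqP: h0; apply: funext => n.
    by apply/eqP; apply: contrapT => /negP hn; apply: hz; exists n.
  exists n => // m ltmn; apply/eqP; apply: contraTT ltmn => /min_n.
  by rewrite -leqNgt.
(* The coefficient at the sum of the two valuations is [f a * g b]. *)
have [a fa fa_min] := low f f0; have [b gb gb_min] := low g g0.
move=> /(congr1 (fun h : fps R => h (a + b)%N)) /eqP.
have lta : (a < (a + b).+1)%N by rewrite ltnS leq_addr.
rewrite fpsME (bigD1 (Ordinal lta)) //= addKn big1 ?addr0.
  by rewrite -[(0 : fps R) _]/(0 : R) mulf_eq0 (negPf fa) (negPf gb).
move=> i; rewrite -val_eqE /= neq_ltn => /orP[/fa_min -> | ltai].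
  by rewrite mul0r.
by rewrite gb_min ?mulr0 // ltn_subLR ?ltn_add2r // -ltnS.
Qed.

HB.instance Definition _ (R : idomainType) :=
  GRing.ComUnitRing_isIntegral.Build (fps R) (@fps_mulf_eq0 R).

(** * Derivations of a fraction field *)

Definition derivation (R : pzRingType) (d : R -> R) : Prop :=
  {morph d : a b / a + b} /\ forall a b, d (a * b) = d a * b + a * d b.

Section FracDerivation.
Local Open Scope quotient_scope.
Variables (R : idomainType) (d : R -> R).
Hypothesis d_der : derivation d.
Local Notation "x %:F" := (@FracField.tofrac R x).

Lemma tofrac_surj (x : {fraction R}) :
  exists u : R * R, u.2 != 0 /\ x * u.2%:F = u.1%:F.
Proof.
have [r ->] : exists r, x = \pi r by exists (repr x); rewrite reprK.
have nz := denom_ratioP r; exists (frac r); split=> //.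
unlock FracField.tofrac; rewrite -[LHS]FracField.pi_mul.
apply/eqmodP; rewrite /= /FracField.mulf /FracField.equivf.
by rewrite !numden_Ratio ?oner_neq0 ?mulr1 // mulrC.
Qed.

Definition frac_der (x : {fraction R}) : {fraction R} :=
  let u := projT1 (cid (tofrac_surj x)) in
  ((d u.1)%:F - x * (d u.2)%:F) / u.2%:F.

(** The quotient rule does not depend on the fraction: differentiating
    [a b' = a' b] shows that two representatives give the same value. *)
Lemma frac_derE x a b : b != 0 -> x * b%:F = a%:F ->
  frac_der x * b%:F = (d a)%:F - x * (d b)%:F.
Proof.
rewrite /frac_der; case: cid => -[a' b'] /= [b'0 xb'] b0 xb.
have F0 c : c != 0 -> c%:F != 0 by rewrite tofrac_eq0.
have ab : a * b' = a' * b.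
  by apply/eqP; rewrite -tofrac_eq !tofracM -xb -xb' mulrAC.
have /(congr1 (@FracField.tofrac R)) := congr1 d ab.
rewrite !(d_der.2) !tofracD !tofracM -xb -xb' => dab.
apply: (mulIf (F0 _ b'0)); rewrite mulrAC divfK ?F0 //.
rewrite !mulrBl; apply/eqP; rewrite -subr_eq0; apply/eqP.
rewrite -[RHS](subrr ((d a')%:F * b%:F + x * b'%:F * (d b)%:F)) -{2}dab.
by ring.
Qed.

Lemma frac_der_tofrac a : frac_der a%:F = (d a)%:F.
Proof.
have d1 : d 1 = 0.
  by apply: (@addIr _ (d 1)); rewrite add0r -{3}[1]mulr1 d_der.2 mulr1 mul1r.
have := @frac_derE a%:F a 1 (oner_neq0 _).
by rewrite tofrac1 !mulr1 d1 tofrac0 mulr0 subr0 => ->.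
Qed.

(** Both identities are checked after clearing denominators. *)
Lemma frac_derP : derivation frac_der.
Proof.
have F0 c : c != 0 -> c%:F != 0 by rewrite tofrac_eq0.
split=> x y; have [[a b] /= [b0 xb]] := tofrac_surj x;
  have [[a' b'] /= [b'0 yb]] := tofrac_surj y.
- apply: (mulIf (F0 _ (mulf_neq0 b0 b'0))).
  rewrite (@frac_derE _ (a * b' + a' * b)) ?mulf_neq0 //; last first.
    by rewrite tofracD !tofracM -xb -yb; ring.
  rewrite d_der.1 !d_der.2 !tofracD !tofracM -xb -yb.
  have -> : (frac_der x + frac_der y) * (b%:F * b'%:F) =
    (frac_der x * b%:F) * b'%:F + (frac_der y * b'%:F) * b%:F by ring.
  by rewrite (frac_derE b0 xb) (frac_derE b'0 yb); ring.
- apply: (mulIf (F0 _ (mulf_neq0 b0 b'0))).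
  rewrite (@frac_derE _ (a * a')) ?mulf_neq0 //; last first.
    by rewrite !tofracM -xb -yb; ring.
  rewrite !d_der.2 !tofracD !tofracM -xb -yb.
  have -> : (frac_der x * y + x * frac_der y) * (b%:F * b'%:F) =
    (frac_der x * b%:F) * (y * b'%:F) + (frac_der y * b'%:F) * (x * b%:F) by ring.
  by rewrite (frac_derE b0 xb) (frac_derE b'0 yb); ring.
Qed.

End FracDerivation.

(** With [t] a denominator of [x], the two derivations commute at [t] and at
    [x * t]; expanding [d (e (x * t))] by the product rule leaves the commutation
    at [x] times [t]. *)
Lemma frac_derC (R : idomainType) (d e : R -> R) :
  derivation d -> derivation e -> (forall a, d (e a) = e (d a)) ->
  forall x, frac_der d (frac_der e x) = frac_der e (frac_der d x).
Proof.
move=> hd he de x; have [[a b] /= [b0 xb]] := tofrac_surj x.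
have DE c : frac_der d (frac_der e (FracField.tofrac c)) =
    frac_der e (frac_der d (FracField.tofrac c)).
  by rewrite !(frac_der_tofrac hd, frac_der_tofrac he) de.
have b0' : FracField.tofrac b != 0 by rewrite tofrac_eq0.
have := DE a; rewrite -xb; move: (DE b).
move: (frac_der d) (frac_der e) (frac_derP hd) (frac_derP he).
move: (FracField.tofrac b) b0' => t t0 D E [DD DM] [ED EM] DEt.
rewrite !(EM, DM) !ED !DD !(EM, DM) DEt => DExt.
apply: (mulIf t0); apply: (addIr (E x * D t + D x * E t + x * E (D t))).
transitivity (D (E x) * t + E x * D t + (D x * E t + x * E (D t))); first by ring.
by rewrite DExt; ring.
Qed.

(** * Series over a differential field *)

Section SeriesDerivation.
Variable F : diffFieldType.
Implicit Types (f g : fps F) (i : 'I_2).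

Definition fps_map_der i f : fps F := fun n => der i (f n).

Definition fps_deriv f : fps F := fun n => f n.+1 *+ n.+1.

Lemma fps_map_derP i : derivation (fps_map_der i).
Proof.
split=> f g; apply: funext => n; first exact: derD.
rewrite fpsDE /fps_map_der !fpsME raddf_sum -big_split.
by apply: eq_bigr => k _; rewrite /= derM.
Qed.

Lemma fps_derivP : derivation fps_deriv.
Proof.
split=> f g; apply: funext => n; first exact: mulrnDl.
rewrite fpsDE.
(* A truncation one term longer is differentiated as a polynomial. *)
pose N := n.+1.
have tr (h : fps F) : (fps_trunc N h)^`() = fps_trunc n (fps_deriv h).
  apply/polyP => k; rewrite coef_deriv !coef_poly ltnS.
  by case: ifP; rewrite ?mul0rn.
rewrite /fps_deriv -/N -[(f * g) N]/((fps_trunc N f * fps_trunc N g)`_N).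
rewrite -coef_deriv derivM !tr coefD.
rewrite !coefM; congr (_ + _); rewrite fpsME; apply: eq_bigr => k _.
- by rewrite !coef_fps_trunc // ?leqW ?leq_subr // -ltnS.
- by rewrite !coef_fps_trunc // ?leq_subr // leqW // -ltnS.
Qed.

Definition fps_dy f : fps F := fps_map_der ord_max f + fps_deriv f.

Lemma fps_dyP : derivation fps_dy.
Proof.
have [aD aM] := fps_map_derP ord_max; have [bD bM] := fps_derivP.
split=> f g; first by rewrite /fps_dy aD bD addrACA.
by rewrite /fps_dy aM bM mulrDl mulrDr addrACA.
Qed.

Lemma fps_dxyC f : fps_map_der ord0 (fps_dy f) = fps_dy (fps_map_der ord0 f).
Proof.
apply: funext => n; rewrite /fps_dy fpsDE /fps_map_der.
by rewrite fpsDE derD derC raddfMn.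
Qed.

Local Notation frac_dx := (frac_der (fps_map_der ord0)).
Local Notation frac_dy := (frac_der fps_dy).

(** The [d/dt] in [d_y] is what makes ordinary equations in [d_y] solvable by
    series: it frees the constant term, while [d_x] still commutes with [d_y]. *)
Definition fps_frac : Type := {fraction (fps F)}.

HB.instance Definition _ := GRing.Field.on fps_frac.

HB.instance Definition _ := Field_isDifferential2.Build fps_frac
  (frac_derP (fps_map_derP ord0)).1 (frac_derP fps_dyP).1
  (frac_derP (fps_map_derP ord0)).2 (frac_derP fps_dyP).2
  (frac_derC (fps_map_derP ord0) fps_dyP fps_dxyC).

End SeriesDerivation.

(** * Solutions of Riccati equations *)

(** Course-of-values recursion: [approx n] is a sequence whose first [n + 1]
    terms are already correct. *)
Lemma fps_recursion (R : Type) (step : fps R -> nat -> R) (u0 : R) :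
  (forall f g n, (forall k, (k <= n)%N -> f k = g k) -> step f n = step g n) ->
  exists u : fps R, u 0%N = u0 /\ forall n, u n.+1 = step u n.
Proof.
move=> step_loc.
pose approx := nat_rect (fun=> fps R) (fun=> u0)
  (fun n f k => if (k <= n)%N then f k else step f n).
have approx_stable n k : (k <= n)%N -> approx n k = approx k k.
  elim: n => [|n IH]; first by rewrite leqn0 => /eqP ->.
  by rewrite leq_eqVlt => /predU1P[-> //|]; rewrite ltnS /= => lekn; rewrite lekn IH.
exists (fun n => approx n n); split=> // n; rewrite /= ltnn.
by apply: step_loc => k /approx_stable.
Qed.

Section Riccati.
Variable F : diffFieldType.
Hypothesis char0 : [pchar F] =i pred0.
Implicit Types p q u : F.

(** Solving for the [d/dt] part of [d_y u] gives [u_(n+1)] in terms of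
    [u_0, ..., u_n]; the division by [n + 1] uses characteristic zero. *)
Lemma fps_riccati p q u0 : exists u : fps F, u 0%N = u0 /\
  fps_dy u + u * u + @fps_const F p * u + @fps_const F q = 0.
Proof.
pose rest (u : fps F) := fps_map_der ord_max u + u * u + @fps_const F p * u + @fps_const F q.
have [|u [uE0 uES]] := @fps_recursion F (fun (f : fps F) n => - rest f n / n.+1%:R) u0.
  move=> f g n fg; congr (- _ / _); rewrite /rest !fpsDE !fps_constME.
  rewrite /fps_map_der fg // !fpsME; congr (_ + _ + _ + _).
  by apply: eq_bigr => k _; rewrite !fg ?leq_subr // -ltnS.
exists u; split=> //; apply: funext => n.
have -> : fps_dy u + u * u + @fps_const F p * u + @fps_const F q = rest u + fps_deriv u.
  by rewrite /fps_dy /rest; ring.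
rewrite fpsDE /fps_deriv uES -[X in _ + X]mulr_natr divfK ?subrr //.
by have /pcharf0P -> := char0.
Qed.

Lemma infinite_field (s : seq F) : exists u, u \notin s.
Proof.
apply: contrapT => sF.
have : (size [seq k%:R : F | k <- iota 0 (size s).+1] <= size s)%N.
  apply: uniq_leq_size => [|u _]; last first.
    by apply: contrapT => /negP us; apply: sF; exists u.
  rewrite map_inj_in_uniq ?iota_uniq // => m n _ _ /eqP.
  wlog lemn : m n / (m <= n)%N.
    by move=> W mn; case/orP: (leq_total m n) => /W; [| rewrite eq_sym => ->]; auto.
  rewrite -(subnKC lemn) natrD -subr_eq0 opprD addrA subrr add0r oppr_eq0.
  by have /pcharf0P -> := char0; move=> /eqP ->; rewrite addn0.
by rewrite size_map size_iota ltnn.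
Qed.

(** The conditions of being a solution and avoiding [s] form a finite system,
    solvable over the series as soon as the constant term avoids [s]. *)
Lemma riccati_solutions (Fclosed : differentially_closed F) p q (s : seq F) :
  exists2 u, u \notin s & der_y u + u * u + p * u + q = 0.
Proof.
pose eqn := DPadd (DPadd (DPadd (DPdy (DPvar 0)) (DPmul (DPvar 0) (DPvar 0)))
  (DPmul (DPconst p) (DPvar 0))) (DPconst q).
pose neqs := [seq DPadd (DPvar 0) (DPconst (- v)) | v <- s].
have [|a [/= /andP[/eqP aE _] ans]] := Fclosed [:: eqn] neqs; last first.
  exists (a 0%N) => //; apply/negP => as_.
  by move: ans; rewrite all_map => /allP/(_ _ as_); rewrite /= subrr eqxx.
have [u0 u0s] := infinite_field s.
have [u [uE0 uE]] := fps_riccati p q u0.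
pose iota : {rmorphism F -> fps_frac F} :=
  (@FracField.tofrac (fps F) \o @fps_const F : {rmorphism F -> {fraction (fps F)}}).
pose t : fps_frac F := FracField.tofrac u.
have dxE f : der_x (FracField.tofrac f : fps_frac F) = FracField.tofrac (fps_map_der ord0 f).
  exact: frac_der_tofrac (@fps_map_derP F ord0) f.
have dyE f : der_y (FracField.tofrac f : fps_frac F) = FracField.tofrac (fps_dy f).
  exact: frac_der_tofrac (fps_dyP F) f.
have mapC i c : fps_map_der i (@fps_const F c) = @fps_const F (der i c).
  by apply: funext => -[|n] //; apply: der0.
exists (fps_frac F), iota; split.
  split=> c; rewrite /= ?dxE ?dyE; congr FracField.tofrac; rewrite ?mapC //.
  rewrite /fps_dy mapC [fps_deriv _](_ : _ = 0) ?addr0 //.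
  by apply: funext => n; apply: mul0rn.
exists (fun=> t); split=> /=.
  rewrite andbT dyE; apply/eqP.
  by rewrite -[RHS](tofrac0 (fps F)) -uE !tofracD !tofracM.
rewrite all_map; apply/allP => v vs; apply: contra u0s => /eqP uv.
suff uE1 : u = @fps_const F v by rewrite -uE0 uE1.
apply/eqP; rewrite -tofrac_eq; apply/eqP/subr0_eq; rewrite -[RHS]uv /=.
by rewrite raddfN tofracN.
Qed.

End Riccati.

(** * Reduction to ordinary operators *)

Section Reduction.
Variable F : diffFieldType.
Implicit Types (I J : set (diffop F)) (P Q : diffop F) (i : 'I_2).

Definition dgen i : diffop F := 'X_i.

Lemma dgenE i Q : dgen i * Q = dmul i Q.
Proof. by rewrite diffop_mulE [LHS]diffop_mulXl -[U_(_)%MM]addm0 dmulmU dmulm0. Qed.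

Lemma dgenZ i c Q : dgen i * (c *: Q) = c *: (dgen i * Q) + der i c *: Q.
Proof. by rewrite !dgenE dmulZ. Qed.

Lemma left_idealZ I c Q : left_ideal I -> I Q -> I (c *: Q).
Proof. by case=> _ _ IM IQ; rewrite -[Q]mul1r scalerAl; apply: IM. Qed.

Lemma left_idealB I P Q : left_ideal I -> I P -> I Q -> I (P - Q).
Proof.
move=> Iid IP IQ; rewrite -scaleN1r; case: (Iid) => _ ID _.
by apply: ID => //; apply: left_idealZ.
Qed.

(** The class of [Q] mod [I] is that of an ordinary operator in [dgen i] of order
    less than [n]. *)
Definition reducible I i n Q : Prop :=
  exists c : nat -> F, I (Q - \sum_(k < n) c k *: dgen i ^+ k).

Lemma reducibleD I i n P Q : left_ideal I ->
  reducible I i n P -> reducible I i n Q -> reducible I i n (P + Q).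
Proof.
move=> [_ ID _] [c Ic] [d Id]; exists (fun k => c k + d k).
under eq_bigr do rewrite scalerDl.
by rewrite big_split /= opprD addrACA; apply: ID.
Qed.

Lemma reducibleZ I i n a Q : left_ideal I ->
  reducible I i n Q -> reducible I i n (a *: Q).
Proof.
move=> Iid [c Ic]; exists (fun k => a * c k).
under eq_bigr do rewrite -scalerA.
by rewrite -scaler_sumr -scalerBr; apply: left_idealZ.
Qed.

Lemma reducible_mem I i n Q : I Q -> reducible I i n Q.
Proof.
by exists (fun=> 0); rewrite big1 ?subr0 // => k _; rewrite scale0r.
Qed.

Lemma reducible_sum I i n (T : Type) (s : seq T) (G : T -> diffop F) :
  left_ideal I -> (forall t, reducible I i n (G t)) ->
  reducible I i n (\sum_(t <- s) G t).
Proof.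
move=> Iid GI; elim/big_rec: _ => [|t P _]; last exact: reducibleD.
by apply: reducible_mem; case: Iid.
Qed.

Lemma reducible_dgenX I i n k : left_ideal I -> (k < n)%N ->
  reducible I i n (dgen i ^+ k).
Proof.
case=> I0 _ _ ltkn; exists (fun j => (j == k)%:R).
rewrite (bigD1 (Ordinal ltkn)) //= eqxx scale1r big1 ?addr0 ?subrr // => j.
by rewrite -val_eqE /= => /negPf ->; rewrite scale0r.
Qed.

Lemma reducible_leq I i m n Q : (m <= n)%N ->
  reducible I i m Q -> reducible I i n Q.
Proof.
move=> lemn [c Ic]; exists (fun k => if (k < m)%N then c k else 0).
rewrite (big_ord_widen n (fun k => c k *: dgen i ^+ k)) // big_mkcond /= in Ic.
by move: Ic; congr (I (_ - _)); apply: eq_bigr => k _; case: ifP; rewrite ?scale0r.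
Qed.

Lemma reducible_trans I i m n Q : left_ideal I ->
  (forall k, (k < m)%N -> reducible I i n (dgen i ^+ k)) ->
  reducible I i m Q -> reducible I i n Q.
Proof.
move=> Iid Dn [c Ic]; rewrite -[Q](subrK (\sum_(k < m) c k *: dgen i ^+ k)).
apply: reducibleD => //; first exact: reducible_mem.
apply: reducible_sum => // k.
by apply: reducibleZ => //; apply: Dn.
Qed.

(** The term [der j c *: dgen i ^+ k] in [dgen j * (c *: dgen i ^+ k)] is
    harmless, so only the images of the powers of [dgen i] matter. *)
Lemma reducible_dgen_mul I i j m n Q : left_ideal I -> (m <= n)%N ->
  (forall k, (k < m)%N -> reducible I i n (dgen j * dgen i ^+ k)) ->
  reducible I i m Q -> reducible I i n (dgen j * Q).
Proof.
move=> Iid lemn Dn [c Ic]; rewrite -[Q](subrK (\sum_(k < m) c k *: dgen i ^+ k)).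
rewrite mulrDr; apply: reducibleD => //.
  by apply: reducible_mem; case: (Iid) => _ _; apply.
rewrite mulr_sumr; apply: reducible_sum => // k; rewrite dgenZ.
apply: reducibleD => //; apply: reducibleZ => //; first exact: Dn.
by apply: reducible_dgenX => //; apply: leq_trans lemn.
Qed.

(** Right division by a monic ordinary operator of order [n] lying in [I]: the
    span of [1, ..., d^(n-1)] mod [I] is then stable under [d]. *)
Lemma reducible_bounded I i n : left_ideal I ->
  reducible I i n (dgen i ^+ n) ->
  forall k, reducible I i n (dgen i ^+ k).
Proof.
move=> Iid In; elim=> [|k IH].
  by case: n In => // n _; apply: reducible_dgenX.
rewrite exprS; apply: reducible_dgen_mul IH => // j ltjn.
rewrite -exprS; case: (ltnP j.+1 n) => [|lenj]; first exact: reducible_dgenX.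
by rewrite (_ : j.+1 = n) //; apply/eqP; rewrite eqn_leq ltjn.
Qed.

(** [Q] is congruent mod [J] to an ordinary operator, non-zero as [Q] is not in
    [J]; after division by its leading coefficient it shows that a power of
    [dgen i] is reducible to lower ones mod [I]. *)
Lemma reducible_monic I J i n Q : left_ideal I -> J `<=` I ->
  I Q -> ~ J Q -> reducible J i n Q -> exists m, reducible I i m (dgen i ^+ m).
Proof.
move=> Iid sJI IQ nJQ [c Jc]; have [_ ID _] := Iid.
elim: n Jc => [|n IH]; first by rewrite big_ord0 subr0.
rewrite big_ord_recr /=; have [-> | cn0 Jc] := eqVneq (c n) 0.
  by rewrite scale0r addr0.
exists n, (fun k => - ((c n)^-1 * c k)).
under eq_bigr do rewrite scaleNr -scalerA.
rewrite sumrN -scaler_sumr opprK -[dgen i ^+ n](scalerK cn0) -scalerDr.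
apply: left_idealZ => //; rewrite addrC.
rewrite -[X in I X](subKr Q); apply: left_idealB => //; exact: sJI.
Qed.

(** More vectors than generators: the coordinates of the former form a matrix
    with a non-zero left kernel vector, that is a linear relation mod [I]. *)
Lemma image_dim_le I V k n (e : 'I_n -> diffop F) : left_ideal I ->
  (forall Q, V Q -> exists c : 'I_n -> F, I (Q - \sum_j c j *: e j)) ->
  image_dim I V k -> (k <= n)%N.
Proof.
move=> Iid eV [b [Vb b_free _]].
have /choice[C IC] : forall r, exists c : 'I_n -> F, I (b r - \sum_j c j *: e j).
  by move=> r; apply: eV.
rewrite leqNgt; apply/negP => ltnk.
pose M : 'M[F]_(k, n) := \matrix_(r, j) C r j.
have : kermx M != 0.
  rewrite kermx_eq0 -row_leq_rank -ltnNge.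
  exact: leq_ltn_trans (rank_leq_col _) ltnk.
case/rowV0Pn => v /sub_kermxP vM0 v0.
have [I0 ID _] := Iid.
case/eqP: v0; apply/rowP => r; rewrite mxE; move: r.
apply: b_free.
have vC0 : \sum_r v 0 r *: (\sum_j C r j *: e j) = 0.
  under eq_bigr do rewrite scaler_sumr; rewrite exchange_big big1 // => j _.
  under eq_bigr do rewrite scalerA; rewrite -scaler_suml.
  have := congr1 (fun A : 'rV_n => A 0 j) vM0; rewrite !mxE => vM0j.
  rewrite [X in X *: _](_ : _ = 0) ?scale0r // -[RHS]vM0j.
  by apply: eq_bigr => r _; rewrite mxE.
rewrite -[X in I X]subr0 -[X in _ - X]vC0 -sumrB; elim/big_rec: _ => // r P _; apply: ID.
by rewrite -scalerBr; apply: left_idealZ.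
Qed.

Lemma bounded_not_linear (h : {poly rat}) (N n : nat) :
  (forall z, (N <= z)%N -> `|h.[z%:R]| <= n%:R) -> size h != 2%N.
Proof.
move=> hn; apply/eqP => h2.
have a0 : h`_1 != 0.
  by have := lead_coef_eq0 h; rewrite lead_coefE -size_poly_eq0 h2 /= => ->.
have hE z : h.[z] = h`_0 + h`_1 * z.
  by rewrite horner_coef h2 big_ord_recl big_ord1 /= mulr1.
have [m ltm] : exists m : nat, n.*2%:R / `|h`_1| < m%:R.
  by exists (Num.bound (n.*2%:R / `|h`_1|)); apply: archi_boundP; rewrite divr_ge0.
have : `|h.[(N + m)%:R] - h.[N%:R]| <= n.*2%:R.
  apply: le_trans (ler_normB _ _) _; rewrite -addnn (natrD _ n n).
  by apply: lerD; apply: hn; rewrite ?leq_addr.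
rewrite !hE opprD addrACA subrr add0r -mulrBr natrD addrC addKr normrM normr_nat.
by apply/negP; rewrite -ltNge mulrC -ltr_pdivrMr ?normr_gt0.
Qed.

(** Proper quotients of a cyclic module over [F[dgen i]] have finite dimension
    [m], which bounds the Hilbert-Kolchin polynomial. *)
Lemma non_holonomic_overideal_cyclic J I i :
  (forall Q, exists n, reducible J i n Q) ->
  overideal J I -> non_holonomic I -> I = J.
Proof.
move=> redJ [Iid sJI] [h [[N hI] h2]]; apply/seteqP; split=> // Q IQ.
apply: contrapT => nJQ; have [n redQ] := redJ Q.
have [m /reducible_bounded redm] := reducible_monic Iid sJI IQ nJQ redQ.
suff /eqP : size h != 2%N by [].
apply: (@bounded_not_linear h N m) => z /hI[k [dimk ->]].
rewrite normr_nat ler_nat.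
apply: (image_dim_le (e := fun k => dgen i ^+ k)) dimk => // R _.
have [l redR] := redJ R.
have [c Ic] : reducible I i m R.
  apply: (@reducible_trans I i l) => // [j _|]; first exact: redm.
  by case: redR => c Jc; exists c; apply: sJI.
by exists (fun k => c k).
Qed.


Lemma reducible_dgen I i n Q : left_ideal I ->
  reducible I i n Q -> reducible I i n.+1 (dgen i * Q).
Proof.
move=> Iid; apply: reducible_dgen_mul => // k ltkn.
by rewrite -exprS; apply: reducible_dgenX.
Qed.

Lemma reducible_dgenX_mul I i n k Q : left_ideal I ->
  reducible I i n Q -> reducible I i (k + n) (dgen i ^+ k * Q).
Proof.
move=> Iid redQ; elim: k => [|k IH]; first by rewrite expr0 mul1r.
by rewrite exprS -mulrA; apply: reducible_dgen.
Qed.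

Lemma reducible_congr I i n P Q : left_ideal I -> I (P - Q) ->
  reducible I i n Q -> reducible I i n P.
Proof.
move=> Iid IPQ redQ; rewrite -(subrK Q P).
by apply: reducibleD => //; apply: reducible_mem.
Qed.

(** If multiplication by [d_x] (resp. [d_y]) raises the order of reduced forms
    by at most [w0] (resp. [w1]), reduced forms are bounded by the weighted
    degree. *)
Lemma reducible_diffop I i w0 w1 N Q : left_ideal I ->
  (forall n R, reducible I i n R -> reducible I i (w0 + n) (Dx * R)) ->
  (forall n R, reducible I i n R -> reducible I i (w1 + n) (Dy * R)) ->
  (forall m, m \in msupp Q -> (m ord0 * w0 + m ord_max * w1 < N)%N) ->
  reducible I i N Q.
Proof.
move=> Iid wx wy QN.
rewrite [Q]diffopE big_seq; elim/big_ind: _ => [||m /QN lemN].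
- by apply: reducible_mem; case: Iid.
- by move=> R S; apply: reducibleD.
apply: reducibleZ => //; apply: reducible_leq lemN _.
have r1 : reducible I i 1 1 by rewrite -(expr0 (dgen i)); apply: reducible_dgenX.
elim: (m ord0) => [|a IH]; last first.
  by rewrite exprS -mulrA mulSn -addnA -addnS; apply: wx.
rewrite expr0 mul1r mul0n add0n; elim: (m ord_max) => [|b IH] //.
by rewrite exprS mulSn -addnS; apply: wy.
Qed.

Lemma left_principal_ideal P : left_ideal (principal_ideal P).
Proof. by case: (principal_idealP P). Qed.

Lemma principal_mulr P Q : principal_ideal P (Q * P).
Proof. by exists Q. Qed.

Lemma dgenC i j : GRing.comm (dgen i) (dgen j).
Proof. by rewrite /GRing.comm !dgenE !dmulX addmC. Qed.

(** [P = 0] reads [d_x = - p1^-1 (d_y^2 + p2 d_y + p3)], whose reduced form has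
    order less than [3]. *)
Lemma reducible_dy (p1 p2 p3 : F) : p1 != 0 -> forall Q, exists n,
  reducible (principal_ideal (Dy ^+ 2 + p1 *: Dx + p2 *: Dy + p3%:A)) ord_max n Q.
Proof.
move=> p10 Q; set P := _ + _; set J := principal_ideal P.
have Jid : left_ideal J by apply: left_principal_ideal.
have redx : reducible J ord_max 3 Dx.
  pose L : diffop F := Dy ^+ 2 + p2 *: Dy + p3%:A.
  apply: (@reducible_congr _ _ _ _ (- p1^-1 *: L)) => //.
    rewrite scaleNr opprK -[Dx](scalerK p10) -scalerDr.
    apply: left_idealZ => //; rewrite /L !addrA (addrC (p1 *: Dx)) -/P.
    by rewrite -[P]mul1r; apply: principal_mulr.
  apply: reducibleZ => //; rewrite /L -[X in p2 *: X]expr1 -[1](expr0 Dy).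
  by do 2?apply: reducibleD => //; try apply: reducibleZ => //; apply: reducible_dgenX.
exists (\max_(m <- msupp Q) (m ord0 * 3 + m ord_max * 1)).+1.
apply: (reducible_diffop (w0 := 3) (w1 := 1)) => //.
- move=> n R; apply: reducible_dgen_mul => //; first exact: leq_addl.
  move=> k ltkn; rewrite (commrX k (dgenC ord0 ord_max)).
  apply: reducible_leq (reducible_dgenX_mul k Jid redx).
  by rewrite addnC leq_add2l ltnW.
- by move=> n R; apply: reducible_dgen.
- by move=> m mQ; rewrite ltnS; apply: (leq_bigmax_seq _ mQ).
Qed.

(** * The left ideal generated by d_y - u *)

Section FirstOrder.
Variable u : F.
Let J := principal_ideal (Dy - u%:A).

Let Jid : left_ideal J. Proof. exact: left_principal_ideal. Qed.

(** Modulo [d_y - u], [d_y d_x^k = d_x^k d_y] becomes [d_x^k u], of order [k]: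
    multiplication by [d_y] does not raise the order of reduced forms. *)
Lemma reducible_dx N Q : (msize Q <= N)%N -> reducible J ord0 N Q.
Proof.
move=> QN; apply: (reducible_diffop (w0 := 1) (w1 := 0)) => //.
- by move=> n R; apply: reducible_dgen.
- move=> n R; rewrite add0n; apply: reducible_dgen_mul => // k ltkn.
  rewrite (commrX k (dgenC ord_max ord0)).
  apply: (@reducible_congr _ _ _ _ (dgen ord0 ^+ k * u%:A)) => //.
    by rewrite -mulrBr; apply: principal_mulr.
  apply: reducible_leq ltkn _; rewrite -(addn1 k); apply: reducible_dgenX_mul => //.
  by apply: reducibleZ => //; rewrite -(expr0 (dgen ord0)); apply: reducible_dgenX.
- move=> m /msize_mdeg_lt /leq_trans/(_ QN); apply: leq_ltn_trans.
  by rewrite muln1 muln0 addn0 mdegE (bigD1 ord0) //= leq_addr.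
Qed.

Definition dy_degree_le (d : nat) Q : Prop := forall m : 'X_{1..2},
  (d < m ord_max)%N -> Q@_m = 0.

Lemma dy_degree_leD d P Q : dy_degree_le d P -> dy_degree_le d Q -> dy_degree_le d (P + Q).
Proof. by move=> hP hQ m dm; rewrite mcoeffD hP ?hQ ?addr0. Qed.

Lemma dy_degree_le_monomial d c (m : 'X_{1..2}) :
  (m ord_max <= d)%N -> dy_degree_le d (c *: 'X_[m]).
Proof.
move=> md k dk; rewrite mcoeffZ mcoeffX; case: eqP => [mk|]; last by rewrite mulr0.
by move: dk; rewrite -mk ltnNge md.
Qed.

Lemma dy_degree_le_sum d (T : eqType) (s : seq T) (G : T -> diffop F) :
  (forall t, t \in s -> dy_degree_le d (G t)) -> dy_degree_le d (\sum_(t <- s) G t).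
Proof.
move=> Gd; rewrite big_seq; elim/big_ind: _ => //; last exact: dy_degree_leD.
by move=> m _; rewrite mcoeff0.
Qed.

Lemma dy_degree_le_dmul d i Q :
  dy_degree_le d Q -> dy_degree_le (d + (i == ord_max)) (dmul i Q).
Proof.
move=> Qd; rewrite [Q]mpolyE raddf_sum /=; apply: dy_degree_le_sum => m mQ.
have md : (m ord_max <= d)%N.
  by rewrite leqNgt; apply: contraL mQ => /Qd Qm; rewrite mcoeff_msupp Qm eqxx.
rewrite dmulZ dmulX; apply: dy_degree_leD; apply: dy_degree_le_monomial.
  by rewrite mnmDE mnm1E addnC leq_add2r.
exact: leq_trans md (leq_addr _ _).
Qed.

(** The monomial as a member of the operator ring, so that products with it are
    products of operators. *)
Definition dmonomial (m : 'X_{1..2}) : diffop F := 'X_[m].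

Lemma dmonomial_Dy m : dmonomial m * Dy = dmonomial (m + U_(ord_max)).
Proof.
rewrite /dmonomial [in LHS]diffop_monomialE -mulrA -exprSr.
by rewrite diffop_monomialE !mnmDE !mnm1E addn0 addn1.
Qed.

Lemma diffop_dmonomialE Q : Q = \sum_(m <- msupp Q) Q@_m *: dmonomial m.
Proof. exact: mpolyE. Qed.

Lemma dy_degree_le_Xscalar (m : 'X_{1..2}) : dy_degree_le (m ord_max) (dmonomial m * u%:A).
Proof.
rewrite diffop_mulE diffop_mulXl /dmulm.
elim: (m ord0) => [|a IH] /=; last by have := @dy_degree_le_dmul _ ord0 _ IH; rewrite addn0.
elim: (m ord_max) => [|b IH] /=; last by have := @dy_degree_le_dmul _ ord_max _ IH; rewrite addn1.
have <- : 'X_[0] = 1 :> diffop F by exact: mpolyX0.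
by apply: dy_degree_le_monomial; rewrite mnm0E.
Qed.

Lemma DxX k : Dx ^+ k = 'X_[U_(ord0) *+ k] :> diffop F.
Proof. by rewrite diffop_monomialE !mulmnE !mnm1E mul1n mul0n expr0 mulr1. Qed.

(** The degree in [d_y] of [A (d_y - u)] is one more than that of [A], so a
    multiple of [d_y - u] free of [d_y] vanishes. *)
Lemma dx_free n (c : nat -> F) :
  J (\sum_(k < n) c k *: Dx ^+ k) -> forall k, (k < n)%N -> c k = 0.
Proof.
move=> [A _ AE].
have [A0 | A0] := eqVneq A 0.
  move=> k ltkn; have := congr1 (fun q : {mpoly F[2]} => q@_(U_(ord0) *+ k)) AE.
  rewrite A0 mul0r mcoeff0 raddf_sum /= (bigD1 (Ordinal ltkn)) //= big1 ?addr0.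
    by rewrite DxX mcoeffZ mcoeffX eqxx mulr1.
  move=> j; rewrite -val_eqE /= DxX mcoeffZ mcoeffX => /eqP jk.
  case: eqP => [/(congr1 (fun m : 'X_{1..2} => m ord0))|]; last by rewrite mulr0.
  by rewrite !mulmnE !mnm1E !mul1n => /jk.
(* Compare the coefficients at [M + U_(ord_max)], where [M] is a monomial of
   [A] of largest degree in [d_y]. *)
have [M MA Mmax] : exists2 M, M \in msupp A &
    forall m, m \in msupp A -> (m ord_max <= M ord_max)%N.
  have [m mA] : exists m, m \in msupp A by exists (mlead A); apply: mlead_supp.
  have [M _ MP] := @arg_maxnP (seq_sub (msupp A)) (SeqSub mA) xpredT (fun m => ssval m ord_max) isT.
  by exists (ssval M) => [|k kA]; [exact: ssvalP | exact: (MP (SeqSub kA))].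
have := congr1 (fun q : {mpoly F[2]} => q@_(M + U_(ord_max))) AE.
have -> : (\sum_(k < n) c k *: Dx ^+ k : diffop F)@_(M + U_(ord_max)) = 0.
  have: dy_degree_le 0 (\sum_(k < n) c k *: Dx ^+ k).
    apply: dy_degree_le_sum => k _; rewrite DxX.
    by apply: dy_degree_le_monomial; rewrite mulmnE mnm1E.
  by apply; rewrite mnmDE mnm1E addn1.
rewrite mulrBr mcoeffB.
have -> : (A * u%:A : diffop F)@_(M + U_(ord_max)) = 0.
  have: dy_degree_le (M ord_max) (A * u%:A).
    rewrite [X in X * _]diffop_dmonomialE mulr_suml; apply: dy_degree_le_sum => m mA k Mk.
    rewrite -scalerAl mcoeffZ dy_degree_le_Xscalar ?mulr0 //.
    exact: leq_ltn_trans (Mmax _ mA) Mk.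
  by apply; rewrite mnmDE mnm1E addn1.
have -> : A * Dy = \sum_(m <- msupp A) A@_m *: dmonomial (m + U_(ord_max)).
  rewrite [X in X * _]diffop_dmonomialE mulr_suml.
  by apply: eq_bigr => m _; rewrite -scalerAl dmonomial_Dy.
rewrite subr0 raddf_sum /= (bigD1_seq M) ?msupp_uniq //= big1 => [|m mM].
  rewrite addr0 mcoeffZ mcoeffX eqxx mulr1 => AM0.
  by move: MA; rewrite mcoeff_msupp AM0 eqxx.
by rewrite mcoeffZ mcoeffX eqm_add2r (negPf mM) mulr0.
Qed.

Lemma first_order_non_holonomic : non_holonomic J.
Proof.
exists ('X + 1%:P); split; last by rewrite size_XaddC.
exists 0%N => z _; exists z.+1; split; last by rewrite !hornerE natr1.
exists (fun k => Dx ^+ k); split.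
- move=> k; rewrite /order_le /= DxX msizeX mdegMn mdeg1 mul1n ltnS.
  by rewrite -ltnS.
- move=> c Jc k; have := @dx_free z.+1 (fun k => c (inord k)).
  under eq_bigr do rewrite inord_val.
  by move=> /(_ Jc k (ltn_ord k)); rewrite inord_val.
- by move=> Q /reducible_dx[c Jc]; exists (fun k => c k).
Qed.

End FirstOrder.

(** The Riccati equation for [u] is the condition under which the operator
    factors as [(d_y + p2 + u) (d_y - u)]. *)
Lemma first_order_maximal (u p2 p3 : F) :
  der_y u + u * u + p2 * u + p3 = 0 ->
  maximal_non_holonomic_overideal
    (principal_ideal (Dy ^+ 2 + p2 *: Dy + p3%:A)) (principal_ideal (Dy - u%:A)).
Proof.
move=> ric; split; [split | exact: first_order_non_holonomic |].
- exact: left_principal_ideal.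
- have [_ _] := principal_idealP (Dy ^+ 2 + p2 *: Dy + p3%:A).
  apply; first exact: left_principal_ideal.
  exists (Dy + (p2 + u)%:A) => //.
  have -> : p3 = - (der_y u + (p2 + u) * u).
    by apply/eqP; rewrite -addr_eq0 addrC mulrDl (addrC (p2 * u)) addrA ric.
  rewrite mulrDl !mulrBr Dy_scalar -!scalerAl !mul1r scalerA -expr2.
  rewrite scaleNr 2!scalerDl !opprD !addrA (addrAC _ (p2 *: Dy)).
  by rewrite (addrAC _ (- (der_y u)%:A)) subrK (addrAC _ (- (der_y u)%:A)).
- move=> M [Mid _] Mnh sJM.
  apply: (@non_holonomic_overideal_cyclic _ _ ord0) => // Q.
  by exists (msize Q); apply: reducible_dx.
Qed.

(** If both [d_y - u] and [d_y - v] lie in [<d_y - u>], so does the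
    operator [u - v] of order zero, which must vanish. *)
Lemma first_order_inj (u v : F) :
  principal_ideal (Dy - u%:A) = principal_ideal (Dy - v%:A) -> u = v.
Proof.
move=> uv; apply/subr0_eq; apply: (@dx_free u 1 (fun=> u - v) _ 0%N) => //.
rewrite big_ord1 expr0 scalerBl.
have -> : u%:A - v%:A = (Dy - v%:A) - (Dy - u%:A) :> diffop F.
  by rewrite opprB [RHS]addrC addrA subrK.
apply: left_idealB; first exact: left_principal_ideal.
  by rewrite uv; case: (principal_idealP (Dy - v%:A)).
by case: (principal_idealP (Dy - u%:A)).
Qed.

End Reduction.

Theorem proposition1 (F : diffFieldType) (char0 : [pchar F] =i pred0)
    (Fclosed : differentially_closed F) (p1 p2 p3 : F) :
  let P : diffop F := Dy ^+ 2 + p1 *: Dx + p2 *: Dy + p3%:A in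
  (p1 != 0 ->
     ~ exists I, proper_overideal (principal_ideal P) I /\ non_holonomic I) /\
  (p1 = 0 ->
     infinite_set
       [set M | maximal_non_holonomic_overideal (principal_ideal P) M]).
Proof.
move=> P; split=> [p10 [I [[PI nPI] Inh]] | p10].
  by apply: nPI; apply: non_holonomic_overideal_cyclic Inh => //; apply: reducible_dy.
have -> : P = Dy ^+ 2 + p2 *: Dy + p3%:A by rewrite /P p10 scale0r addr0.
move=> /(finite_preimage (f := fun u : F => principal_ideal (Dy - u%:A))) fin.
have /finite_seqP[s sE] := fin (in2W (@first_order_inj F)).
have [u /negP us ric] := riccati_solutions char0 Fclosed p2 p3 s.
apply: us; suff : [set` s] u by [].
by rewrite -sE; apply: first_order_maximal.
Qed.
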